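(* For every real $\delta>0$ there exists an integer $K(\delta)\geq1$ such that, for every integer $N\geq1$ and every $E\subseteq\mathbb{Z}_N^2$ satisfying $|E|\geq\delta N^2$, there exists a (positive) divisor $d\mid N$ with $d\leq K(\delta)$ such that $$d\mathbb{Z}_N\subseteq\{uv:(u,v)\in E-E\}.$$
   Context: $\mathbb{Z}_N=\mathbb{Z}/N\mathbb{Z}$ is the ring of integers modulo $N$. $E-E=\{a-b:a,b\in E\}\subseteq\mathbb{Z}_N^2$, and products $uv$ are taken in $\mathbb{Z}_N$. *)

(* Defs.v *)
From HB Require Import structures.
From mathcomp Require Import all_boot all_order all_algebra.

Set Implicit Arguments.
Unset Strict Implicit.
Unset Printing Implicit Defensive.

Import GRing.Theory.
Local Open Scope ring_scope.

(* 'Z_N is Z/2 for N = 1 (and N = 0), so the ring Z/NZ is put on an alias of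
   the ordinals: for N >= 1 the carrier is {0, ..., N - 1} with addition and
   multiplication modulo N, including the zero ring at N = 1.  At N = 0 the
   alias is again the zero ring, not Z. *)
Definition Zmod (N : nat) : Type := 'I_N.-1.+1.

HB.instance Definition _ (N : nat) := Finite.on (Zmod N).
HB.instance Definition _ (N : nat) := GRing.Zmodule.on (Zmod N).
HB.instance Definition _ (N : nat) :=
  GRing.Zmodule_isComPzRing.Build (Zmod N)
    (@Zp_mulA N.-1.+1) (@Zp_mulC N.-1.+1) (@Zp_mul1z N.-1)
    (@Zp_mul_addl N.-1.+1).

Lemma card_Zmod (N : nat) : (0 < N)%N -> #|{: Zmod N}| = N.
Proof. by move=> N_gt0; rewrite card_ord prednK. Qed.

Lemma Zmod_natr (N : nat) : (0 < N)%N -> N%:R = 0 :> Zmod N.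
Proof.
move=> N_gt0; apply: val_inj; have := @Zp_mulrn N.-1 (Zp1 : 'I_N.-1.+1) N.
by move/(congr1 val) => /= ->; rewrite modnMml prednK // mul1n modnn.
Qed.

Lemma Zmod_mulE (N : nat) (x y : Zmod N) :
  (0 < N)%N -> x * y = (x * y %% N)%N :> nat.
Proof. by case: N x y. Qed.

Definition diff_set (N : nat) (E : {set Zmod N * Zmod N}) :
    {set Zmod N * Zmod N} :=
  [set a - b | a : Zmod N * Zmod N in E, b : Zmod N * Zmod N in E].

Definition coord_products (N : nat) (S : {set Zmod N * Zmod N}) :
    {set Zmod N} :=
  [set w.1 * w.2 | w in S].

Definition multiples (N d : nat) : {set Zmod N} :=
  [set d%:R * x | x : Zmod N].

(* Main.v *)
Require Import Defs.
From mathcomp Require Import all_boot all_order all_algebra reals.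
From mathcomp Require Import all_field ring zify.

Set Implicit Arguments.
Unset Strict Implicit.
Unset Printing Implicit Defensive.

Import Order.TTheory GRing.Theory Num.Theory.
Local Open Scope ring_scope.

(** Write [G] for the set of pairs [(x, y)] with [x y = 1] in [Z_N]. Fix large
integers [m] and [J], let [L] be the factorial of a large [threshold] depending
on [m], and put [D = L^J]. For [s] in [Z_N], every point
[(L^i x, L^(J-i) s y)] with [i < J] and [(x, y)] in [G] lies on the hyperbola
[u v = D s]. The claim is that one of these points belongs to [E - E] as soon
as [J] and [m] are large in terms of [delta]; then [D s] is a product of the
required kind for every [s], and the divisor [d = gcd(D, N)], which generates
the same ideal of [Z_N] as [D], is at most [D] whatever [N] is.

If none of the points is a difference, expand the indicator function of [E] in
characters: the sum over all characters [c] of [|F(c)|^2 S(c)] vanishes, where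
[F] is the Fourier transform of [E] and [S(c)] adds the values of [c] over all
the points ([fourier_correlation]). For fixed [i] the sum of [c] over the
points is a Kloosterman sum with parameters [A^(L^i)] and [B^(L^(J-i))], where
the [N]-th roots of unity [A] and [B] depend only on [c] and [s]. Three things
can happen.
- Both parameters are [1]: the sum is [|G|]. For the trivial character this
  occurs at every scale [i].
- The [L]-th powers of the parameters are not both [1]: the sum is at most
  [|G| / m] ([kloosterman_bound]).
- Neither: then [i] is the last scale before the powers of [A] become trivial,
  or the first one after those of [B] have ceased to be, so there are at most
  two such scales for a given [c] ([card_critical_scale]).
Hence [S(c)] is a nonnegative number plus an error of size at most
[(2 + J/m) |G|]. The trivial character contributes [J |G| |E|^2], and Parseval
bounds the errors by [(2 + J/m) |G| |E| N^2], which is a contradiction when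
[2/J + 1/m < delta] ([dense_product_differences]).

The bound on Kloosterman sums is a weak but uniform one. Modulo a prime power
[q = p^k] it comes from Kloosterman's fourth moment argument: a sum takes the
same absolute value at the [|G|] parameters obtained by dilating
([kloosterman_dilate]), while the sum of all fourth powers counts the solutions
of [g1 + g2 = g3 + g4] in [G]. Such a solution satisfies
[(x1 + x2)(x3 - x1)(x3 - x2) = 0], so that one factor is divisible by about
[p^(k/3)], and this saves a factor [p^(k/3)] over the trivial count, without
distinguishing primes from higher powers or odd [p] from [2]. A general modulus
is reduced to this one: if the [L]-th powers of the parameters are not both
[1], some large prime power [q = p^k] exactly divides their joint order, every
inverse pair modulo [q] lifts to one modulo [N] that is trivial away from [p],
and averaging over the dilations by these lifts turns the sum into Kloosterman
sums modulo [q]. *)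

(** * The ring of integers modulo N *)

Section Zmod.
Variables (N : nat) (N_gt0 : (0 < N)%N).
Implicit Types x y : Zmod N.

Lemma Zmod_lt x : (x < N)%N.
Proof. by case: N N_gt0 x => // n _ x; apply: ltn_ord. Qed.

Lemma Zmod_addE x y : (x + y)%R = ((x + y)%N %% N)%N :> nat.
Proof. by case: N N_gt0 x y. Qed.

Lemma Zmod_natE n : (n%:R : Zmod N) = (n %% N)%N :> nat.
Proof.
elim: n => [|n IHn]; first by rewrite mod0n.
have one_mod : (1 : Zmod N) = (1 %% N)%N :> nat by case: N N_gt0.
by rewrite mulrSr Zmod_addE IHn modnDml one_mod modnDmr addn1.
Qed.

Lemma Zmod_valK x : (x : nat)%:R = x.
Proof. by apply/val_inj; rewrite /= Zmod_natE modn_small ?Zmod_lt. Qed.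

Lemma Zmod_natr_eq m n : (m%:R == n%:R :> Zmod N) = (m == n %[mod N]).
Proof. by rewrite -val_eqE /= !Zmod_natE. Qed.

End Zmod.

Lemma norm_unity_root n (z : algC) : (0 < n)%N -> z ^+ n = 1 -> `|z| = 1.
Proof.
by move=> n_gt0 zn; apply/eqP; rewrite -(pexpr_eq1 n_gt0) // -normrX zn normr1.
Qed.

(** * Additive characters and correlations *)

Section Characters.
Variables (N : nat) (w : algC).
Hypotheses (N_gt0 : (0 < N)%N) (prim_w : N.-primitive_root w).
Local Notation A := (Zmod N).

Definition echar (x : A) : algC := w ^+ x.

Lemma echar_nat n : echar n%:R = w ^+ n.
Proof. by rewrite /echar Zmod_natE // prim_expr_mod. Qed.

Lemma echar0 : echar 0 = 1.
Proof. by rewrite -[0]/(0%:R) echar_nat. Qed.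

Lemma echarD x y : echar (x + y) = echar x * echar y.
Proof.
by rewrite -[x]Zmod_valK // -[y]Zmod_valK // -natrD !echar_nat exprD.
Qed.

Lemma echarX x n : echar x ^+ n = echar (n%:R * x).
Proof. by rewrite -[x in RHS]Zmod_valK // -natrM echar_nat mulnC exprM. Qed.

Lemma echarMn x y : echar x ^+ (y : A) = echar (x * y).
Proof. by rewrite echarX Zmod_valK // mulrC. Qed.

Lemma echar_order x : echar x ^+ N = 1.
Proof. by rewrite echarX Zmod_natr // mul0r echar0. Qed.

Lemma norm_echar x : `|echar x| = 1.
Proof. exact: norm_unity_root (echar_order x). Qed.

Lemma conj_echar x : (echar x)^* = echar (- x).
Proof.
rewrite -[RHS]mul1r -[X in X * _](expr1n _ 2%N) -(norm_echar x) normCKC.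
by rewrite -mulrA -echarD subrr echar0 mulr1.
Qed.

Lemma sum_echar x : \sum_(a : A) echar (a * x) = (x == 0)%:R * N%:R.
Proof.
have [->|x_neq0] := eqVneq x 0.
  under eq_bigr do rewrite mulr0 echar0.
  by rewrite sumr_const card_Zmod // mul1r.
(* The sum is invariant under the shift a -> 1 + a, which multiplies it by
   the value echar x, different from 1. *)
have : (1 - echar x) * \sum_(a : A) echar (a * x) = 0.
  rewrite mulrBl mul1r [X in _ - X]big_distrr /=.
  rewrite [X in X - _](reindex_inj (addrI 1)) /=.
  apply/eqP; rewrite subr_eq0; apply/eqP/eq_bigr => a _.
  by rewrite -echarD mulrDl mul1r.
move=> /eqP; rewrite mulf_eq0 subr_eq0 => /orP[|/eqP ->]; last by rewrite mul0r.
rewrite eq_sym -[1](expr0 w) /echar (eq_prim_root_expr prim_w).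
rewrite mod0n modn_small ?Zmod_lt // => /eqP x0.
by case/eqP: x_neq0; rewrite -[x]Zmod_valK // x0.
Qed.

Definition echar2 (c z : A * A) : algC := echar (c.1 * z.1 + c.2 * z.2).

Lemma echar2D c z z' : echar2 c (z + z') = echar2 c z * echar2 c z'.
Proof. by rewrite /echar2 -echarD; congr echar; rewrite /=; ring. Qed.

Lemma conj_echar2 c z : (echar2 c z)^* = echar2 c (- z).
Proof. by rewrite /echar2 conj_echar /= !mulrN opprD. Qed.

Lemma sum_echar2 z : \sum_c echar2 c z = (z == 0)%:R * N%:R ^+ 2.
Proof.
rewrite /echar2 -(pair_big predT predT (fun a b => echar (a * z.1 + b * z.2))) /=.
under eq_bigr do under eq_bigr do rewrite echarD.
rewrite -big_distrlr /= !sum_echar mulrACA -expr2 -natrM mulnb.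
by case: z.
Qed.

(** Indexing by an arbitrary family of points, rather than by a set of points,
makes the transform of a set and the square of a Kloosterman sum (the family
of all sums of two inverse pairs) instances of the same definition. *)
Definition fourier (I : finType) (X : {set I}) (f : I -> A * A) c :=
  \sum_(i in X) echar2 c (f i).

(** Expanding the square, orthogonality of the characters keeps exactly the
pairs of indices whose points differ by [t]. The left-hand side is thus zero
when [t] is not a difference, while [t = 0] is Parseval's identity. *)
Lemma fourier_correlation (I : finType) (X : {set I}) (f : I -> A * A) t :
  \sum_c `|fourier X f c| ^+ 2 * echar2 c t =
  #|[set ij in setX X X | f ij.1 + t == f ij.2]|%:R * N%:R ^+ 2.
Proof.
under eq_bigr => c _.
  rewrite normCK /fourier rmorph_sum big_distrlr big_distrl /=.
  under eq_bigr => i _.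
    rewrite big_distrl /=.
    under eq_bigr => j _ do rewrite /= conj_echar2 mulrAC -!echar2D.
    over.
  over.
rewrite exchange_big /=.
under eq_bigr do rewrite exchange_big /=.
under eq_bigr do under eq_bigr do rewrite sum_echar2 subr_eq0.
rewrite pair_big /= -big_distrl /= -natr_sum; congr (_%:R * _).
rewrite -sum1_card [RHS]big_mkcond /= [LHS]big_mkcond; apply: eq_bigr => -[i j] _.
by rewrite !inE; case: (_ && _) => //=; case: eqP.
Qed.
End Characters.

(** * Inverse pairs and Kloosterman sums *)

(** The graph of the inversion of units; [x] and its inverse play symmetric
roles throughout. *)
Definition inv_pairs (N : nat) : {set Zmod N * Zmod N} :=
  [set g | g.1 * g.2 == 1].

(** The parameters are the roots of unity [A] and [B] themselves, not residues
[a] and [b] in [exp(2 i pi (a x + b y) / N)], so that changing the modulus or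
taking powers of the parameters needs no translation. *)
Definition kloosterman (N : nat) (A B : algC) : algC :=
  \sum_(g in inv_pairs N) A ^+ (g.1 : Zmod N) * B ^+ (g.2 : Zmod N).

Lemma coprime_inverse N x : (0 < N)%N -> coprime x N ->
  exists y, x * y = 1 %[mod N].
Proof.
move=> N_gt0 cxN; have := chinese_modl cxN 0 1; have := chinese_modr cxN 0 1.
set z := chinese _ _ _ _ => zN; rewrite mod0n => /eqP/dvdnP[y def_z].
by exists y; rewrite mulnC -def_z.
Qed.

Section InvPairs.
Variables (N : nat) (N_gt0 : (0 < N)%N).
Local Notation A := (Zmod N).
Local Notation G := (inv_pairs N).

Lemma inv_pairs_coprime x : coprime x N -> exists y : A, (x%:R, y) \in G.
Proof.
move=> cxN; have [y xy] := coprime_inverse N_gt0 cxN.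
by exists y%:R; rewrite inE /= -natrM -[1]/(1%:R) Zmod_natr_eq // xy.
Qed.

Lemma coprime_inv_pairs g : g \in G -> coprime (g.1 : A) N.
Proof.
rewrite inE => /eqP/(congr1 (@nat_of_ord _)).
rewrite -[1]/(1%:R : A) Zmod_natE // Zmod_mulE // => eq1.
have: coprime ((g.1 : A) * (g.2 : A))%N N.
  by rewrite -coprime_modl eq1 coprime_modl coprime1n.
by rewrite coprimeMl => /andP[].
Qed.

Lemma inv_pairs_mul h g : h \in G -> ((h.1 * g.1, h.2 * g.2) \in G) = (g \in G).
Proof. by rewrite !inE /= => /eqP h1; rewrite mulrACA h1 mul1r. Qed.

Lemma inv_pairs_swap g : g \in G -> (g.2, g.1) \in G.
Proof. by rewrite !inE mulrC. Qed.

Lemma inv_pairs_mul_inj h : h \in G ->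
  injective (fun g : A * A => (h.1 * g.1, h.2 * g.2)).
Proof.
rewrite inE => /eqP h1.
apply: (can_inj (g := fun g => (h.2 * g.1, h.1 * g.2))) => -[x y] /=.
by rewrite !mulrA h1 [h.2 * _]mulrC h1 !mul1r.
Qed.

Lemma inv_pairs_fst_inj : {in G &, injective (fun g => g.1)}.
Proof.
move=> [x y] [x' y']; rewrite !inE /= => /eqP xy /eqP xy' eqx; congr (_, _) => //.
by rewrite -[y]mul1r -xy' -eqx mulrAC xy mul1r.
Qed.

Lemma totient_le_card_inv_pairs : (totient N <= #|G|)%N.
Proof.
have -> : totient N = #|[set x : A | coprime N x]|.
  rewrite totient_count_coprime big_mkord -sum1_card.
  rewrite [RHS]big_mkcond /=; case: N N_gt0 => // n _.
  by apply: eq_bigr => i _; rewrite inE; case: coprime.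
apply: leq_trans (leq_imset_card fst G); apply/subset_leq_card/subsetP => x.
rewrite inE coprime_sym => /inv_pairs_coprime[y Gxy].
by apply/imsetP; exists (x, y); rewrite // Zmod_valK in Gxy *.
Qed.
End InvPairs.

Lemma expr_Zmod_mul N (A : algC) (x y : Zmod N) : (0 < N)%N -> A ^+ N = 1 ->
  A ^+ (x * y)%R = (A ^+ x) ^+ y.
Proof. by move=> N_gt0 AN; rewrite Zmod_mulE // expr_mod // exprM. Qed.

(** The change of variables [g -> h g] in the sum. *)
Lemma kloosterman_dilate N (A B : algC) h : (0 < N)%N ->
    A ^+ N = 1 -> B ^+ N = 1 -> h \in inv_pairs N ->
  kloosterman N (A ^+ h.1) (B ^+ h.2) = kloosterman N A B.
Proof.
move=> N_gt0 AN BN Gh; rewrite /kloosterman.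
rewrite [RHS](reindex_inj (inv_pairs_mul_inj Gh)) /=.
apply: eq_big => [g|g _]; first by rewrite inv_pairs_mul.
by rewrite !expr_Zmod_mul.
Qed.

Lemma kloosterman_echar N w (c : Zmod N * Zmod N) :
    (0 < N)%N -> N.-primitive_root w ->
  kloosterman N (echar w c.1) (echar w c.2) = \sum_(g in inv_pairs N) echar2 w c g.
Proof.
move=> N_gt0 prim_w; apply: eq_bigr => g _.
by rewrite /echar2 echarD // !echarMn.
Qed.

(** * The additive energy of the inverse pairs modulo a prime power *)

Lemma card_setX_fibers (I J : finType) (X : {set I}) (Y : {set J})
    (P : I -> J -> bool) n :
    (forall i, i \in X -> #|[set j in Y | P i j]| <= n)%N ->
  (#|[set ij in setX X Y | P ij.1 ij.2]| <= #|X| * n)%N.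
Proof.
move=> leXn; rewrite -sum1_card.
pose Y_ i := [set j in Y | P i j].
rewrite (eq_bigl (fun ij : I * J => (ij.1 \in X) && (ij.2 \in Y_ ij.1)));
  last by case=> i j; rewrite !inE /= andbA.
rewrite -(pair_big_dep (mem X) (fun i j => j \in Y_ i) (fun _ _ => 1%N)) /=.
by rewrite -sum_nat_const leq_sum // => i Xi; rewrite sum1_card leXn.
Qed.

(** Otherwise each valuation is at most [j - 1], and they add up to less than
[k] because [3 j - 3 < k]. *)
Lemma prime_power_dvd_mul3 p k j x y z : prime p -> (3 * j <= k + 2)%N ->
  (p ^ k %| x * y * z)%N -> [|| p ^ j %| x, p ^ j %| y | p ^ j %| z]%N.
Proof.
move=> p_pr le_3jk.
have [-> | x_gt0] := posnP x; first by rewrite dvdn0.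
have [-> | y_gt0] := posnP y; first by rewrite dvdn0 orbT.
have [-> | z_gt0] := posnP z; first by rewrite dvdn0 !orbT.
rewrite !pfactor_dvdn ?muln_gt0 ?x_gt0 ?y_gt0 // !lognM ?muln_gt0 ?x_gt0 ?y_gt0 //.
move=> le_k; apply: contraT.
rewrite !negb_or -!ltnNge => /and3P[lt_x lt_y lt_z]; lia.
Qed.

Lemma card_dvdn_translate N d (c : Zmod N) : (0 < N)%N -> (d %| N)%N ->
  (#|[set y : Zmod N | d %| (c + y)%R]| * d <= N)%N.
Proof.
move=> N_gt0 dvdN; have d_gt0 := dvdn_gt0 N_gt0 dvdN.
rewrite -[leqRHS](divnK dvdN) leq_mul2r; apply/orP; right.
pose f (y : Zmod N) : 'I_((N %/ d).-1.+1) := inord ((c + y)%R %/ d).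
have lt_f (y : Zmod N) : ((c + y)%R %/ d < (N %/ d).-1.+1)%N.
  rewrite [ltnRHS]prednK ?divn_gt0 ?(dvdn_leq N_gt0) // ltn_divLR // divnK //.
  exact: Zmod_lt.
have f_inj: {in [set y : Zmod N | d %| (c + y)%R]%N &, injective f}.
  move=> y z; rewrite !inE => dy dz /(congr1 val); rewrite /= !inordK //.
  move=> /(congr1 (muln^~ d)); rewrite !divnK // => /val_inj.
  exact: addrI.
rewrite -(card_in_imset f_inj); apply: leq_trans (max_card _) _.
by rewrite card_ord prednK ?divn_gt0 ?(dvdn_leq N_gt0).
Qed.

Definition sum_pair (V : zmodType) (gh : V * V) : V := gh.1 + gh.2.

(** Substitute [x4 = x1 + x2 - x3] and [y4 = y1 + y2 - y3] in [x4 y4 = 1] and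
multiply by [x1 x2 x3] to clear the inverses [y1], [y2], [y3]. *)
Lemma inv_pairs_additive_energy_eq N (g1 g2 g3 g4 : Zmod N * Zmod N) :
    g1 \in inv_pairs N -> g2 \in inv_pairs N ->
    g3 \in inv_pairs N -> g4 \in inv_pairs N ->
    g1 + g2 = g3 + g4 ->
  (g1.1 + g2.1) * (- g1.1 + g3.1) * (- g2.1 + g3.1) = 0.
Proof.
case: g1 g2 g3 g4 => [x1 y1] [x2 y2] [x3 y3] [x4 y4]; rewrite !inE /=.
move=> /eqP xy1 /eqP xy2 /eqP xy3 /eqP xy4 eq_g.
have eqx : x1 + x2 = x3 + x4 by have := congr1 fst eq_g.
have eqy : y1 + y2 = y3 + y4 by have := congr1 snd eq_g.
have := xy4.
have -> : x4 = x1 + x2 - x3 by rewrite eqx; ring.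
have -> : y4 = y1 + y2 - y3 by rewrite eqy; ring.
move=> /(congr1 (fun z => x1 * x2 * x3 * z)).
have -> : x1 * x2 * x3 * ((x1 + x2 - x3) * (y1 + y2 - y3)) =
  (x1 + x2 - x3) * (x2 * x3 * (x1 * y1) + x1 * x3 * (x2 * y2)
    - x1 * x2 * (x3 * y3)) by ring.
rewrite xy1 xy2 xy3 !mulr1 => eq4.
have -> : (x1 + x2) * (- x1 + x3) * (- x2 + x3) =
  - ((x1 + x2 - x3) * (x2 * x3 + x1 * x3 - x1 * x2) - x1 * x2 * x3) by ring.
by rewrite eq4 subrr oppr0.
Qed.

Section PrimePower.
Variables (p k : nat) (p_pr : prime p) (k_gt0 : (0 < k)%N).
Local Notation q := (p ^ k)%N.
Local Notation A := (Zmod q).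
Local Notation G := (inv_pairs q).

Let q_gt0 : (0 < q)%N. Proof. by rewrite expn_gt0 prime_gt0. Qed.

(** The trivial count is [|G|^3], as three of the pairs determine the fourth.
Here two of the three coordinates [x1], [x2], [x3] are free, and the third one
is confined to a residue class modulo [p^j] by one of the three factors of the
relation above. *)
Lemma inv_pairs_additive_energy j : (j <= k)%N -> (3 * j <= k + 2)%N ->
  (#|[set ij in setX (setX G G) (setX G G) |
        sum_pair ij.1 == sum_pair ij.2]| * p ^ j <= 3 * #|G| ^ 2 * q)%N.
Proof.
move=> le_jk le_3jk; set S := [set _ in _ | _].
have dvd_pj : (p ^ j %| q)%N by rewrite dvdn_exp2l.
set d := (p ^ j)%N in dvd_pj *.
have fiber (c : A) : (#|[set h in G | d %| (c + h.1)%R]| <= q %/ d)%N.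
  rewrite leq_divRL ?(dvdn_gt0 q_gt0) //.
  apply: leq_trans (card_dvdn_translate c q_gt0 dvd_pj).
  rewrite leq_mul2r -(card_in_imset (f := fst)) ?(dvdn_gt0 q_gt0) //; last first.
    by move=> g h /setIdP[Gg _] /setIdP[Gh _]; apply: inv_pairs_fst_inj.
  apply/orP; right; apply/subset_leq_card/subsetP => _ /imsetP[h /setIdP[_ dh] ->].
  by rewrite inE.
pose T1 := setX [set gh in setX G G | d %| (gh.1.1 + gh.2.1)%R]%N G.
pose T2 := [set t in setX (setX G G) G | d %| (- t.1.1.1 + t.2.1)%R]%N.
pose T3 := [set t in setX (setX G G) G | d %| (- t.1.2.1 + t.2.1)%R]%N.
(* Three of the pairs determine the fourth. *)
pose phi (ij : ((A * A) * (A * A)) * ((A * A) * (A * A))) := (ij.1, ij.2.1).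
have phi_inj : {in S &, injective phi}.
  move=> [g [g3 g4]] [h [h3 h4]] /setIdP[_ /eqP]; rewrite /sum_pair /=.
  move=> eg /setIdP[_ /eqP]; rewrite /sum_pair /= => eh [eq_gh eq3].
  by rewrite eq_gh eq3 in eg *; move: eg; rewrite eh => /addrI ->.
have sub : phi @: S \subset T1 :|: T2 :|: T3.
  apply/subsetP=> _ /imsetP[[[g1 g2] [g3 g4]] /setIdP[]] + + ->.
  rewrite !in_setX /sum_pair /= => /andP[/andP[G1 G2] /andP[G3 G4]] /eqP eq_g.
  set x := (g1.1 + g2.1)%R; set y := (- g1.1 + g3.1)%R.
  set z := (- g2.1 + g3.1)%R.
  have : ((x * y * z)%N%:R == 0%:R :> A).
    rewrite !natrM !Zmod_valK //; apply/eqP.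
    exact: inv_pairs_additive_energy_eq G1 G2 G3 G4 eq_g.
  rewrite Zmod_natr_eq // mod0n => /(prime_power_dvd_mul3 p_pr le_3jk).
  rewrite !inE /= -/d; move: G1 G2 G3; rewrite !inE => -> -> -> /=.
  by case/or3P => dvd; rewrite dvd ?orbT.
have le1 : (#|T1| <= #|G| ^ 2 * (q %/ d))%N.
  rewrite cardsX mulnAC leq_mul2r; apply/orP; right.
  apply: (card_setX_fibers (P := fun g h : A * A => d %| (g.1 + h.1)%R)%N).
  by move=> g _; apply: fiber.
have leX (P : (A * A) * (A * A) -> (A * A) -> bool) :
    (forall gh, #|[set h in G | P gh h]| <= q %/ d)%N ->
    (#|[set t in setX (setX G G) G | P t.1 t.2]| <= #|G| ^ 2 * (q %/ d))%N.
  move=> leP; rewrite -[(_ ^ 2)%N]/(_ * _)%N -cardsX.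
  by apply: card_setX_fibers => gh _; apply: leP.
have le2 : (#|T2| <= #|G| ^ 2 * (q %/ d))%N.
  by apply: (leX (fun gh h => d %| (- gh.1.1 + h.1)%R)%N) => gh; apply: fiber.
have le3 : (#|T3| <= #|G| ^ 2 * (q %/ d))%N.
  by apply: (leX (fun gh h => d %| (- gh.2.1 + h.1)%R)%N) => gh; apply: fiber.
have -> : (3 * #|G| ^ 2 * q = 3 * #|G| ^ 2 * (q %/ d) * d)%N.
  by rewrite -[RHS]mulnA divnK.
rewrite -(card_in_imset phi_inj) leq_mul2r.
apply/orP; right; apply: leq_trans (subset_leq_card sub) _.
apply: leq_trans (leq_card_setU _ _) _.
have := (leq_card_setU T1 T2).1; rewrite -mulnA; move: le1 le2 le3.
move: (#|T1|) (#|T2|) (#|T3|) (#|_ :|: _|) (_ * (q %/ d))%N => *; lia.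
Qed.

Lemma card_inv_pairs_prime_power : (q <= 2 * #|G|)%N.
Proof.
have := totient_le_card_inv_pairs q_gt0; rewrite totient_pfactor //.
rewrite -(leq_pmul2l (isT : 0 < 2)%N); apply: leq_trans.
rewrite mulnA -[X in (p ^ X)%N](prednK k_gt0) expnS leq_mul2r.
have := prime_gt1 p_pr; lia.
Qed.

(** The square of a Kloosterman sum is the Fourier transform of the family of
sums of two inverse pairs, so this is Parseval's identity for that family. *)
Lemma kloosterman_fourth_moment w : q.-primitive_root w ->
  \sum_(c : A * A) `|kloosterman q (echar w c.1) (echar w c.2)| ^+ 4 =
  #|[set ij in setX (setX G G) (setX G G) |
       sum_pair ij.1 == sum_pair ij.2]|%:R * q%:R ^+ 2.
Proof.
move=> prim_w; transitivity
    (\sum_c `|fourier w (setX G G) (@sum_pair (A * A)%type) c| ^+ 2 * echar2 w c 0).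
  apply: eq_bigr => c _; rewrite {1}/echar2 !mulr0 addr0 echar0 // mulr1.
  rewrite kloosterman_echar // -[4%N]/(2 * 2)%N exprM -normrX; congr (`|_| ^+ _).
  rewrite expr2 big_distrlr /= pair_big /=; apply: eq_big => [[g h]|[g h] _].
    by rewrite in_setX.
  by rewrite -echar2D.
rewrite fourier_correlation //; congr (_%:R * _).
by apply: eq_card => ij; rewrite !inE addr0.
Qed.

(** The [24] is [3 * 2^3]: the three factors in the energy bound, and the cube
of the ratio [q / |G| <= 2]. The fourth power of [m] comes from the fourth
moment, and the cube from the loss of [p^k] to about [p^(k/3)]. *)
Definition threshold (m : nat) : nat := ((24 * m ^ 4) ^ 3)%N.

(** With [|G| >= q / 2], the fourth moment and the energy bound show that the
fourth power of a sum is at most [24 |G|^4 / p^j], where [j = (k + 2) / 3] rounded down. Since [p^k] exceeds the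
threshold and [3 j >= k], the denominator [p^j] exceeds [24 m^4]. The condition
on [a] and [b] says that one of them has order exactly [q]; it makes the orbit
of the parameters under dilation as large as possible. *)
Lemma kloosterman_prime_power (m : nat) a b :
    (threshold m < q)%N -> a ^+ q = 1 -> b ^+ q = 1 ->
    ~~ ((a ^+ (p ^ k.-1) == 1) && (b ^+ (p ^ k.-1) == 1)) ->
  m%:R * `|kloosterman q a b| <= #|G|%:R.
Proof.
move=> lt_mq aq bq nontriv.
have [w prim_w] := C_prim_root_exists q_gt0.
have [i def_a] := prim_rootP prim_w aq; have [j def_b] := prim_rootP prim_w bq.
pose c : A * A := (i%:R, j%:R).
have ea : a = echar w c.1 by rewrite echar_nat.
have eb : b = echar w c.2 by rewrite echar_nat.
have coprime_exp n : (w ^+ n) ^+ (p ^ k.-1) != 1 -> coprime n q.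
  rewrite -exprM -(prim_order_dvd prim_w) => ndvd.
  rewrite coprime_sym coprimeXl // prime_coprime //; apply: contra ndvd => dvd_n.
  by rewrite -(prednK k_gt0) expnS dvdn_mul.
have inj_mul n : (w ^+ n) ^+ (p ^ k.-1) != 1 -> injective (fun x : A => n%:R * x).
  move=> /coprime_exp/inv_pairs_coprime-/(_ q_gt0)[y].
  rewrite inE /= mulrC => /eqP yn; apply: (can_inj (g := fun x => y * x)) => x.
  by rewrite mulrA yn mul1r.
pose phi (h : A * A) : A * A := (c.1 * h.1, c.2 * h.2).
have phi_inj : {in G &, injective phi}.
  move=> g h Gg Gh eq_phi.
  have /= eq1 := congr1 fst eq_phi; have /= eq2 := congr1 snd eq_phi.
  move: nontriv; rewrite negb_and def_a def_b => /orP[/inj_mul inj | /inj_mul inj].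
    exact: inv_pairs_fst_inj Gg Gh (inj _ _ eq1).
  pose swap (g : A * A) := (g.2, g.1).
  apply: (can_in_inj (f := swap) (g := swap) _ Gg Gh) => [[]//|].
  apply: inv_pairs_fst_inj (inv_pairs_swap Gg) (inv_pairs_swap Gh) (inj _ _ eq2).
pose K (c' : A * A) := `|kloosterman q (echar w c'.1) (echar w c'.2)| ^+ 4.
(* The |G| dilates of c are distinct and give the same sum. *)
have le_orbit : #|G|%:R * K c <= \sum_c K c.
  rewrite -sumr_const mulr_suml.
  have -> : \sum_(h in G) 1 * K c = \sum_(c' in phi @: G) K c'.
    rewrite big_imset //=; apply: eq_bigr => h Gh.
    by rewrite mul1r /K /phi /= -!echarMn // kloosterman_dilate // -?ea -?eb.
  rewrite [leRHS](bigID (mem (phi @: G))) /= lerDl.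
  by apply: sumr_ge0 => c' _; rewrite exprn_ge0.
rewrite (kloosterman_fourth_moment prim_w) in le_orbit.
pose l := ((k + 2) %/ 3)%N.
have le_lk : (l <= k)%N by rewrite /l; lia.
have le_3l : (3 * l <= k + 2)%N by rewrite /l; lia.
have le_k3l : (k <= l * 3)%N by rewrite /l; lia.
have := inv_pairs_additive_energy le_lk le_3l.
have lt_mP : (24 * m ^ 4 < p ^ l)%N.
  rewrite -(@ltn_exp2r _ _ 3) // -expnM; apply: leq_trans lt_mq _.
  by rewrite leq_pexp2l // prime_gt0.
have := card_inv_pairs_prime_power.
move: le_orbit; rewrite /K -ea -eb.
set g := #|G|; set S := #|[set _ in _ | _]|; set P := (p ^ l)%N.
move=> le_orbit le_qg le_S.
have g_gt0 : (0 < g)%N by move: le_qg; lia.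
have P_gt0 : (0 < P)%N by apply: leq_ltn_trans lt_mP.
have le_nat : (m ^ 4 * (S * q ^ 2) * P <= g ^ 4 * (g * P))%N.
  apply: (@leq_trans (m ^ 4 * (3 * g ^ 2 * q ^ 3))).
    have -> : (m ^ 4 * (S * q ^ 2) * P = m ^ 4 * (S * P * q ^ 2))%N by ring.
    have -> : (3 * g ^ 2 * q ^ 3 = 3 * g ^ 2 * q * q ^ 2)%N by ring.
    by rewrite leq_mul2l leq_mul2r le_S !orbT.
  apply: (@leq_trans (m ^ 4 * (3 * g ^ 2 * (2 * g) ^ 3))).
    by rewrite leq_mul2l leq_mul2l leq_exp2r // le_qg !orbT.
  have -> : (m ^ 4 * (3 * g ^ 2 * (2 * g) ^ 3) = g ^ 5 * (24 * m ^ 4))%N by ring.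
  have -> : (g ^ 4 * (g * P) = g ^ 5 * P)%N by ring.
  by rewrite leq_mul2l (ltnW lt_mP) orbT.
suff: (m%:R * `|kloosterman q a b|) ^+ 4 <= g%:R ^+ 4.
  by rewrite ler_pXn2r ?nnegrE ?mulr_ge0 ?ler0n.
have gP_gt0 : 0 < (g * P)%:R :> algC by rewrite ltr0n muln_gt0 g_gt0.
rewrite -(ler_pM2r gP_gt0) exprMn.
apply: le_trans (_ : (m ^ 4 * (S * q ^ 2) * P)%:R <= _); last first.
  by rewrite -natrX -natrM ler_nat.
set x := `|_| in le_orbit *.
have -> : m%:R ^+ 4 * x ^+ 4 * (g * P)%:R = (m ^ 4 * P)%:R * (g%:R * x ^+ 4).
  by rewrite !natrM natrX; ring.
have -> : (m ^ 4 * (S * q ^ 2) * P)%:R =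
    (m ^ 4 * P)%:R * (S%:R * q%:R ^+ 2) :> algC.
  by rewrite !(natrX, natrM); ring.
by rewrite ler_wpM2l ?ler0n.
Qed.

End PrimePower.

(** * Kloosterman sums to a general modulus *)

Lemma inv_pairs_modn n (g : Zmod n * Zmod n) : (0 < n)%N -> g \in inv_pairs n ->
  (g.1 * g.2)%N = 1 %[mod n].
Proof.
move=> n_gt0; rewrite inE => /eqP eq1; apply/eqP.
by rewrite -Zmod_natr_eq // natrM !Zmod_valK // eq1.
Qed.

Lemma expr_inv_pair N (z : algC) g n : (0 < N)%N -> g \in inv_pairs N ->
  z ^+ N = 1 -> (z ^+ (g.1 : Zmod N)) ^+ n = 1 -> z ^+ n = 1.
Proof.
move=> N_gt0 Gg zN /(congr1 (fun y => y ^+ (g.2 : Zmod N))).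
rewrite expr1n -!exprM mulnCA -(expr_mod _ zN) -modnMmr.
by rewrite inv_pairs_modn // modnMmr muln1 expr_mod.
Qed.

Lemma eqn_mod_parts p n x y : (0 < n)%N ->
  x = y %[mod n`_p] -> x = y %[mod n`_p^'] -> x = y %[mod n].
Proof.
move=> n_gt0 xy xy'; rewrite -(partnC p n_gt0); apply/eqP.
by rewrite chinese_remainder ?coprime_partC // xy xy' !eqxx.
Qed.

Section Lift.
Variables (N o p : nat).
Hypotheses (N_gt0 : (0 < N)%N) (dvd_oN : (o %| N)%N).
Hypotheses (p_pr : prime p) (dvd_po : (p %| o)%N).
Local Notation q := (o`_p)%N.
Local Notation o' := (o`_p^')%N.

Let o_gt0 : (0 < o)%N. Proof. exact: dvdn_gt0 dvd_oN. Qed.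
Let q_gt0 : (0 < q)%N. Proof. exact: part_gt0. Qed.
Let co_qo' : coprime q o'. Proof. exact: coprime_partC. Qed.

(** An inverse pair modulo the [p]-part [q] of [o] is lifted to [N] by the
Chinese remainder theorem between the [p]-part of [N] and the rest: a residue
prime to [p] stays a unit modulo any power of [p], and the lift is taken to be
[1] away from [p]. Only its class modulo [o] is recorded. *)
Lemma inv_pairs_lift : exists f : Zmod q * Zmod q -> Zmod N * Zmod N,
  forall h, h \in inv_pairs q -> [/\ f h \in inv_pairs N,
    (f h).1 = chinese q o' h.1 1 %[mod o] &
    (f h).2 = chinese q o' h.2 1 %[mod o]].
Proof.
apply: (fin_all_exists (P := fun h fh => h \in inv_pairs q ->
  [/\ fh \in inv_pairs N, fh.1 = chinese q o' h.1 1 %[mod o] &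
      fh.2 = chinese q o' h.2 1 %[mod o]])) => h.
have [Gh | _] := boolP (h \in inv_pairs q); last by exists (0, 0).
set x := nat_of_ord h.1; set y := nat_of_ord h.2.
have xy : (x * y = 1 %[mod q])%N by apply: inv_pairs_modn.
have co_NP := coprime_partC p N N.
pose u := chinese N`_p N`_p^' x 1.
have uP : u = x %[mod N`_p] by apply: chinese_modl.
have uP' : u = 1 %[mod N`_p^'] by apply: chinese_modr.
have co_xp : coprime x p.
  apply: coprime_dvdr (coprime_inv_pairs q_gt0 Gh).
  by rewrite p_part dvdn_exp // logn_gt0 mem_primes p_pr o_gt0.
have co_uN : coprime u N.
  rewrite -(partnC p N_gt0) coprimeMr -coprime_modl uP coprime_modl.
  rewrite -[X in _ && X]coprime_modl uP' coprime_modl coprime1n andbT.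
  by rewrite p_part coprimeXr.
have [v uv] := coprime_inverse N_gt0 co_uN.
have dvd_q : (q %| N`_p)%N by apply: partn_dvd.
have dvd_o' : (o' %| N`_p^')%N by apply: partn_dvd.
have uq : u = x %[mod q] by rewrite -(modn_dvdm _ dvd_q) uP modn_dvdm.
have uo' : u = 1 %[mod o'] by rewrite -(modn_dvdm _ dvd_o') uP' modn_dvdm.
have uvd d : (d %| o)%N -> (u * v = 1 %[mod d])%N.
  by move=> /dvdn_trans/(_ dvd_oN) dvd_d; rewrite -(modn_dvdm _ dvd_d) uv modn_dvdm.
have vq : v = y %[mod q].
  rewrite -[v]muln1 -modnMmr -xy modnMmr mulnCA -modnMml -uq modnMml mulnA.
  by rewrite -modnMml uvd ?dvdn_part // modnMml mul1n.
have vo' : v = 1 %[mod o'].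
  by rewrite -[v]mul1n -modnMml -uo' modnMml uvd // dvdn_part.
exists (u%:R, v%:R) => _; split.
- by rewrite inE /= -natrM -[1]/(1%:R) Zmod_natr_eq // uv.
- rewrite /= Zmod_natE // modn_dvdm //.
  by apply: (@eqn_mod_parts p); rewrite // ?chinese_modl // chinese_modr.
- rewrite /= Zmod_natE // modn_dvdm //.
  by apply: (@eqn_mod_parts p); rewrite // ?chinese_modl // chinese_modr.
Qed.
End Lift.

(** The joint order [o] of the parameters does not divide the factorial of the
threshold, so some prime power exactly dividing [o] exceeds it. Dilating by the lifts
of the inverse pairs modulo that prime power [q] and averaging expresses the
sum through the inner sums over the lifts, which are Kloosterman sums modulo
[q] up to a factor of modulus one. *)
Lemma kloosterman_bound N (m : nat) (A B : algC) : (0 < N)%N ->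
    A ^+ N = 1 -> B ^+ N = 1 ->
    ~~ ((A ^+ (threshold m)`! == 1) && (B ^+ (threshold m)`! == 1)) ->
  m%:R * `|kloosterman N A B| <= #|inv_pairs N|%:R.
Proof.
move=> N_gt0 AN BN nontriv.
have [oA prim_A dvd_oA] := prim_order_exists N_gt0 AN.
have [oB prim_B dvd_oB] := prim_order_exists N_gt0 BN.
pose o := lcmn oA oB; have dvd_oN : (o %| N)%N by rewrite dvdn_lcm dvd_oA.
have oP x : (o %| x)%N = (A ^+ x == 1) && (B ^+ x == 1).
  by rewrite dvdn_lcm !(prim_order_dvd prim_A, prim_order_dvd prim_B).
have o_gt0 := dvdn_gt0 N_gt0 dvd_oN.
rewrite -oP in nontriv.
have [p p_pi ndvd_q] :
    exists2 p : nat, p \in \pi(o) & ~~ (o`_p %| (threshold m)`!)%N.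
  have /allPn[p p_o ndvd] :
      ~~ all (fun p : nat => o`_p %| (threshold m)`!)%N (primes o).
    apply: contra nontriv => /allP dvd_all; apply/dvdn_partP => // p p_pi.
  by exists p.
have [p_pr dvd_po] : prime p /\ (p %| o)%N.
  by move: p_pi; rewrite mem_primes => /and3P[].
set k := logn p o; have def_q : (o`_p = p ^ k)%N by rewrite p_part.
have k_gt0 : (0 < k)%N by rewrite logn_gt0.
have co_qo' : coprime o`_p o`_p^' by apply: coprime_partC.
have lt_q : (threshold m < o`_p)%N.
  rewrite ltnNge; apply: contra ndvd_q => le_q; apply: dvdn_fact.
  by rewrite part_gt0.
have [f fP] := inv_pairs_lift N_gt0 dvd_oN p_pr dvd_po.
(* For z of order dividing o, the factors z ^+ nu and z ^+ nu' are the parts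
   of z whose orders are a power of p and prime to p, respectively. *)
pose nu := chinese o`_p o`_p^' 1 0; pose nu' := chinese o`_p o`_p^' 0 1.
have split_chinese x : chinese o`_p o`_p^' x 1 = nu * x + nu' %[mod o].
  apply: (@eqn_mod_parts p) => //; rewrite -modnDm -modnMml.
    by rewrite /nu /nu' !chinese_modl // modnMml mul1n mod0n addn0 modn_mod.
  by rewrite /nu /nu' !chinese_modr // mod0n mul0n mod0n add0n modn_mod.
pose term (g : Zmod N * Zmod N) h :=
  A ^+ (g.1 * (f h).1)%R * B ^+ (g.2 * (f h).2)%R.
pose H := inv_pairs o`_p.
have inner (g : Zmod N * Zmod N) : g \in inv_pairs N ->
    m%:R * `|\sum_(h in H) term g h| <= #|H|%:R.
  move=> Gg; pose a := A ^+ g.1; pose b := B ^+ g.2.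
  have [/eqP Ao /eqP Bo] : A ^+ o == 1 /\ B ^+ o == 1 by apply/andP; rewrite -oP.
  have ao : a ^+ o = 1 by rewrite exprAC Ao expr1n.
  have bo : b ^+ o = 1 by rewrite exprAC Bo expr1n.
  have expr_modo (z : algC) x y : z ^+ o = 1 -> x = y %[mod o] -> z ^+ x = z ^+ y.
    by move=> zo xy; rewrite -(expr_mod _ zo) xy expr_mod.
  have split_exp (z : algC) x : z ^+ (nu * x + nu') = z ^+ nu' * (z ^+ nu) ^+ x.
    by rewrite exprD exprM mulrC.
  have -> : \sum_(h in H) term g h =
      a ^+ nu' * b ^+ nu' * kloosterman o`_p (a ^+ nu) (b ^+ nu).
    rewrite /kloosterman big_distrr /=; apply: eq_bigr => h /fP[_ f1 f2].
    rewrite /term !expr_Zmod_mul // -/a -/b.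
    rewrite (expr_modo _ _ _ ao (etrans f1 (split_chinese _))).
    rewrite (expr_modo _ _ _ bo (etrans f2 (split_chinese _))).
    by rewrite !split_exp mulrACA.
  rewrite !normrM (normrX nu' a) (normrX nu' b).
  rewrite (norm_unity_root o_gt0 ao) (norm_unity_root o_gt0 bo) !expr1n !mul1r.
  have nu_q_kill (z : algC) : z ^+ o = 1 -> (z ^+ nu) ^+ o`_p = 1.
    have /dvdnP[t def_nu] : (o`_p^' %| nu)%N.
      by rewrite /dvdn chinese_modr // mod0n.
    move=> zo; rewrite def_nu -exprM -mulnA [(_ * o`_p)%N]mulnC partnC //.
    by rewrite mulnC exprM zo expr1n.
  rewrite /H def_q; apply: kloosterman_prime_power => //; rewrite -?def_q //.
  - exact: nu_q_kill.
  - exact: nu_q_kill.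
  (* Otherwise nu * p ^ (k - 1) would kill A and B, so that q, which is prime to
     nu, would divide p ^ (k - 1). *)
  apply/negP => /andP[a_kill b_kill].
  have : (o %| nu * p ^ k.-1)%N.
    rewrite oP; apply/andP; split; apply/eqP.
      by apply: (expr_inv_pair N_gt0 Gg AN); rewrite exprM; apply/eqP.
    apply: (expr_inv_pair N_gt0 (inv_pairs_swap Gg) BN).
    by rewrite exprM; apply/eqP.
  move/(dvdn_trans (dvdn_part p o)); rewrite Gauss_dvdr; last first.
    by rewrite coprime_sym -coprime_modl chinese_modl // coprime_modl coprime1n.
  by rewrite def_q dvdn_Pexp2l ?prime_gt1 // leqNgt ltn_predL k_gt0.
have average : #|H|%:R * kloosterman N A B =
    \sum_(g in inv_pairs N) \sum_(h in H) term g h.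
  rewrite exchange_big -sumr_const mulr_suml; apply: eq_bigr => h /fP[Gfh _ _].
  rewrite mul1r -(kloosterman_dilate N_gt0 AN BN Gfh); apply: eq_bigr => g _.
  by rewrite /term -!expr_Zmod_mul // (mulrC (f h).1) (mulrC (f h).2).
have H_gt0 : 0 < #|H|%:R :> algC.
  by rewrite ltr0n; apply/card_gt0P; exists (1, 1); rewrite inE mulr1.
rewrite -(ler_pM2l H_gt0) mulrCA -[X in X * `|_|]normr_nat -normrM average.
apply: le_trans
  (_ : m%:R * \sum_(g in inv_pairs N) `|\sum_(h in H) term g h| <= _).
  by rewrite ler_wpM2l ?ler0n // ler_norm_sum.
rewrite mulr_sumr mulrC -[X in _ <= X * _]sumr_const mulr_suml.
by apply: ler_sum => g Gg; rewrite mul1r inner.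
Qed.

(** * Averaging over scales *)

Lemma expr_expn_le1 (z : algC) L i j : (i <= j)%N ->
  z ^+ (L ^ i) == 1 -> z ^+ (L ^ j) == 1.
Proof. by move=> le_ij /eqP zi; rewrite -(subnKC le_ij) expnD exprM zi expr1n. Qed.

Lemma card_le1_antichain J (P : pred 'I_J) :
  (forall i j, P i -> P j -> ~~ (i < j)%N) -> (#|P| <= 1)%N.
Proof.
move=> notlt; apply/card_le1_eqP => i j Pi Pj; apply/val_inj.
have [/negP nij /negP nji] := (notlt i j Pi Pj, notlt j i Pj Pi).
by case: (ltngtP i j).
Qed.

Section Scales.
Variables (L J : nat) (A B : algC).

Definition trivial_scale (i : 'I_J) :=
  (A ^+ (L ^ i) == 1) && (B ^+ (L ^ (J - i)) == 1).

Definition critical_scale (i : 'I_J) :=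
  [&& ~~ trivial_scale i, A ^+ (L ^ i.+1) == 1 & B ^+ (L ^ (J - i).+1) == 1].

(** As [i] grows the powers of [A] become and remain trivial, while those of [B]
may cease to be trivial and never become so again. A critical scale is the last
one before the first transition, or the first one after the second. *)
Lemma card_critical_scale : (#|critical_scale| <= 2)%N.
Proof.
pose P (i : 'I_J) := (A ^+ (L ^ i) != 1) && (A ^+ (L ^ i.+1) == 1).
pose Q (i : 'I_J) := (B ^+ (L ^ (J - i)) != 1) && (B ^+ (L ^ (J - i).+1) == 1).
have le_P : (#|P| <= 1)%N.
  apply: card_le1_antichain => i j /andP[_ Pi] /andP[Pj _].
  by apply: contra Pj => lt_ij; apply: expr_expn_le1 Pi.
have le_Q : (#|Q| <= 1)%N.
  apply: card_le1_antichain => i j /andP[Qi _] /andP[_ Qj].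
  apply: contra Qi => lt_ij; apply: expr_expn_le1 Qj.
  by rewrite ltn_sub2l // (leq_trans lt_ij) // ltnW.
apply: (@leq_trans #|[predU P & Q]|).
  apply/subset_leq_card/subsetP => i.
  rewrite !unfold_in /critical_scale /trivial_scale negb_and /P /Q.
  by move=> /and3P[+ -> ->]; rewrite !andbT.
apply: leq_trans (leq_addr #|[predI P & Q]| _) _.
by rewrite cardUI (leq_add le_P le_Q).
Qed.

(** The trivial bound serves for the at most two critical scales, and the bound
on Kloosterman sums for the other ones. *)
Lemma sum_nontrivial_scales N m : (0 < N)%N -> A ^+ N = 1 -> B ^+ N = 1 ->
    L = (threshold m)`! ->
  m%:R * `|\sum_(i < J | ~~ trivial_scale i)
             kloosterman N (A ^+ (L ^ i)) (B ^+ (L ^ (J - i)))|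
    <= ((2 * m + J) * #|inv_pairs N|)%:R.
Proof.
move=> N_gt0 AN BN def_L; pose g := #|inv_pairs N|.
pose K (i : 'I_J) := kloosterman N (A ^+ (L ^ i)) (B ^+ (L ^ (J - i))).
have powN (z : algC) n : z ^+ N = 1 -> (z ^+ n) ^+ N = 1.
  by move=> zN; rewrite exprAC zN expr1n.
have norm1 (z : algC) n : z ^+ N = 1 -> `|z ^+ n| = 1.
  by move=> zN; rewrite (norm_unity_root N_gt0) ?powN.
have bound i : ~~ trivial_scale i ->
    m%:R * `|K i| <= (m * g * critical_scale i + g)%:R.
  move=> ntriv; have [crit | ncrit] := boolP (critical_scale i).
    rewrite muln1 natrD -[X in X <= _]addr0 lerD ?ler0n // natrM.
    rewrite ler_wpM2l ?ler0n //; apply: le_trans (ler_norm_sum _ _ _) _.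
    under eq_bigr do rewrite normrM -!exprM !norm1 // mulr1.
    by rewrite sumr_const.
  rewrite muln0 add0n; apply: kloosterman_bound; rewrite ?powN //.
  rewrite -!exprM -!def_L -!expnSr.
  by move: ncrit; rewrite /critical_scale ntriv.
apply: le_trans (_ : m%:R * \sum_(i < J | ~~ trivial_scale i) `|K i| <= _).
  by rewrite ler_wpM2l ?ler0n // ler_norm_sum.
rewrite mulr_sumr; apply: le_trans (ler_sum _ _) _; first exact: bound.
rewrite -natr_sum ler_nat.
apply: (@leq_trans (\sum_(i < J) (m * g * critical_scale i + g))).
  by rewrite [leqRHS](bigID trivial_scale) /= leq_addl.
rewrite big_split /= -big_distrr /= sum_nat_const card_ord.
have -> : (\sum_(i < J) critical_scale i = #|critical_scale|)%N.
  rewrite -sum1_card [RHS]big_mkcond; apply: eq_bigr => i _.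
  by rewrite -[i \in _]/(critical_scale i); case: (critical_scale i).
have := card_critical_scale; rewrite -/g; nia.
Qed.
End Scales.

(** * Products of the coordinates of differences *)

(** With [m = 2 n] and [J = 8 n] the error [2/J + 1/m] is [3/(4 n)], below the
density, which is at least [1/n]. *)
Lemma dense_product_differences n L N (E : {set Zmod N * Zmod N}) (s : Zmod N) :
    L = (threshold (2 * n))`! -> (0 < n)%N -> (0 < N)%N ->
    (N ^ 2 <= n * #|E|)%N ->
  (L ^ (8 * n))%:R * s \in coord_products (diff_set E).
Proof.
move=> def_L n_gt0 N_gt0 dense; set J := (8 * n)%N; set m := (2 * n)%N.
apply: contraT => notin.
have [w prim_w] := C_prim_root_exists N_gt0.
set G := inv_pairs N.
pose t (i : 'I_J) (g : Zmod N * Zmod N) : Zmod N * Zmod N :=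
  ((L ^ i)%:R * g.1, (L ^ (J - i))%:R * s * g.2).
pose F := fourier w E id.
(* The point t i g lies on the hyperbola u v = L ^ J s, so that it is not a
   difference of two points of E. *)
have no_diff i g : g \in G -> \sum_c `|F c| ^+ 2 * echar2 w c (t i g) = 0.
  rewrite inE => /eqP g1; rewrite fourier_correlation //.
  rewrite (_ : [set _ in _ | _] = set0) ?cards0 ?mul0r //.
  apply/setP => -[P P']; rewrite !inE; apply/negP.
  move=> /andP[/andP[/= EP EP'] /eqP /= eq_t].
  case/negP: notin; apply/imsetP; exists (t i g).
    by apply/imset2P; exists P' P => //; rewrite -eq_t addrC addKr.
  rewrite /= mulrACA g1 mulr1 mulrA -natrM -expnD subnKC //.
  exact: ltnW.
pose A (c : Zmod N * Zmod N) := echar w c.1.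
pose B (c : Zmod N * Zmod N) := echar w (c.2 * s).
pose K c (i : 'I_J) := kloosterman N (A c ^+ (L ^ i)) (B c ^+ (L ^ (J - i))).
have sum_t c i : \sum_(g in G) echar2 w c (t i g) = K c i.
  rewrite /K /kloosterman; apply: eq_bigr => g _.
  rewrite /echar2 echarD // /A /B !echarX // !Zmod_valK //.
  by congr (_ * _); congr echar; rewrite /t; cbn [fst snd]; ring.
have sum0 : \sum_c `|F c| ^+ 2 * \sum_i K c i = 0.
  under eq_bigr do (under eq_bigr do rewrite -sum_t).
  under eq_bigr do rewrite mulr_sumr.
  rewrite exchange_big /= big1 // => i _; under eq_bigr do rewrite mulr_sumr.
  by rewrite exchange_big /= big1 // => g /no_diff.
pose T c (i : 'I_J) := trivial_scale L (A c) (B c) i.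
have K_triv c i : T c i -> K c i = #|G|%:R.
  rewrite /K => /andP[/eqP -> /eqP ->]; rewrite /kloosterman.
  by under eq_bigr do rewrite !expr1n mulr1; rewrite sumr_const.
pose triv_part c := \sum_(i | T c i) K c i.
pose rest c := \sum_(i | ~~ T c i) K c i.
have parseval : \sum_c `|F c| ^+ 2 = (#|E| * N ^ 2)%:R.
  transitivity (\sum_c `|F c| ^+ 2 * echar2 w c 0).
    by apply: eq_bigr => c _; rewrite /echar2 !mulr0 addr0 echar0 // mulr1.
  rewrite fourier_correlation // natrM natrX; congr (_%:R * _).
  rewrite -[RHS](card_imset _ (f := fun P => (P, P))); last by move=> P Q [].
  apply: eq_card => -[P Q]; rewrite !inE /= addr0; apply/idP/imsetP.
    by case/andP=> /andP[EP _] /eqP <-; exists P.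
  by case=> P' EP' [-> ->]; rewrite EP' eqxx.
have triv_ge0 c : 0 <= `|F c| ^+ 2 * triv_part c.
  rewrite mulr_ge0 ?exprn_ge0 // sumr_ge0 // => i /K_triv ->; exact: ler0n.
(* Of all the terms only the one of the trivial character is kept. *)
have main_le : (#|E| ^ 2 * (J * #|G|))%:R <= \sum_c `|F c| ^+ 2 * triv_part c.
  pose c0 : Zmod N * Zmod N := (0, 0).
  rewrite (bigD1 c0) //= -[X in X <= _]addr0 lerD ?sumr_ge0 //.
  have -> : F c0 = #|E|%:R.
    rewrite /F /fourier; under eq_bigr do rewrite /echar2 !mul0r addr0 echar0 //.
    by rewrite sumr_const.
  have T0 i : T c0 i.
    by rewrite /T /trivial_scale /A /B mul0r echar0 // !expr1n eqxx.
  rewrite /triv_part; under eq_bigl do rewrite T0.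
  under eq_bigr do rewrite K_triv //.
  by rewrite sumr_const card_ord normr_nat -[_ *+ J]mulr_natl -!natrX -!natrM.
have rest_eq : \sum_c `|F c| ^+ 2 * triv_part c = - \sum_c `|F c| ^+ 2 * rest c.
  apply/eqP; rewrite -addr_eq0 -big_split /= -[X in _ == X]sum0; apply/eqP.
  by apply: eq_bigr => c _; rewrite -mulrDr [\sum_i K c i](bigID (T c)).
have rest_le : m%:R * `|\sum_c `|F c| ^+ 2 * rest c| <=
    ((2 * m + J) * #|G| * (#|E| * N ^ 2))%:R.
  apply: le_trans (_ : m%:R * \sum_c `| `|F c| ^+ 2 * rest c| <= _).
    by rewrite ler_wpM2l ?ler0n // ler_norm_sum.
  rewrite natrM -parseval !mulr_sumr; apply: ler_sum => c _.
  rewrite normrM normrX normr_id mulrCA [leRHS]mulrC ler_wpM2l ?exprn_ge0 //.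
  by apply: sum_nontrivial_scales def_L => //; apply: echar_order.
have le_nat : (m * (#|E| ^ 2 * (J * #|G|)) <=
    (2 * m + J) * #|G| * (#|E| * N ^ 2))%N.
  rewrite -(ler_nat algC) natrM; apply: le_trans rest_le.
  rewrite ler_wpM2l ?ler0n //.
  by rewrite -normrN -rest_eq ger0_norm // sumr_ge0.
have G_gt0 : (0 < #|G|)%N by apply/card_gt0P; exists (1, 1); rewrite inE mulr1.
have E_gt0 : (0 < #|E|)%N.
  by case: (posnP #|E|) dense => // ->; rewrite muln0 leqn0 expn_eq0 andbT; lia.
move: le_nat; rewrite /m /J; move: dense G_gt0 E_gt0.
move: (#|G|) (#|E|) (N ^ 2)%N => g e M dense g_gt0 e_gt0 le_nat.
have: (16 * n ^ 2 * e * (e * g) <= 12 * n * M * (e * g))%N by move: le_nat; nia.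
rewrite leq_pmul2r ?muln_gt0 ?e_gt0 //; nia.
Qed.

(** Bezout's identity; the ideals are in fact equal. *)
Lemma multiples_gcdn N D : (0 < N)%N -> (0 < D)%N ->
  multiples N (gcdn D N) \subset multiples N D.
Proof.
move=> N_gt0 D_gt0; apply/subsetP => _ /imsetP[x _ ->].
have [u v eq_uv _] := egcdnP N D_gt0.
apply/imsetP; exists (u%:R * x) => //.
have -> : (gcdn D N)%:R = D%:R * u%:R :> Zmod N.
  by rewrite -natrM mulnC eq_uv natrD natrM Zmod_natr // mulr0 add0r.
by rewrite mulrA.
Qed.

Theorem corollary1p9 (R : realType) (delta : R) (delta_gt0 : 0 < delta) :
  exists K : nat, (1 <= K)%N /\
    forall (N : nat) (E : {set Zmod N * Zmod N}),
      (1 <= N)%N ->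
      delta * N%:R ^+ 2 <= #|E|%:R ->
      exists d : nat,
        [/\ (0 < d)%N, (d %| N)%N, (d <= K)%N &
            multiples N d \subset coord_products (diff_set E)].
Proof.
pose n := Num.bound delta^-1.
have lt_n : delta^-1 < n%:R by apply: archi_boundP; rewrite invr_ge0 ltW.
have n_gt0 : (0 < n)%N by rewrite -(ltr0n R) (lt_trans _ lt_n) // invr_gt0.
pose L := (threshold (2 * n))`!.
have D_gt0 : (0 < L ^ (8 * n))%N by rewrite expn_gt0 fact_gt0.
exists (L ^ (8 * n))%N; split=> // N E N_gt0 dense.
exists (gcdn (L ^ (8 * n)) N); split.
- by rewrite gcdn_gt0 N_gt0 orbT.
- exact: dvdn_gcdr.
- by rewrite dvdn_leq // dvdn_gcdl.
apply: subset_trans (multiples_gcdn N_gt0 D_gt0) _.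
apply/subsetP => _ /imsetP[s _ ->]; apply: dense_product_differences => //.
rewrite -(ler_nat R) natrM natrX.
apply: le_trans (_ : n%:R * (delta * N%:R ^+ 2) <= _).
  rewrite mulrA; apply: ler_peMl; first by rewrite exprn_ge0.
  by rewrite -ler_pdivrMr // div1r ltW.
by rewrite ler_wpM2l.
Qed.
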